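(* Let $k\geq 5$ be an integer and let $\vec{G}$ be a $k$-dicritical oriented graph embedded in a surface with Euler characteristic $c$. Then \[ n(\vec{G}) \leq \frac{-3c}{k-4}. \]
   Context: All surfaces are closed (and connected). An oriented graph is a digraph obtained from a finite simple graph (its underlying graph) by replacing each edge by exactly one of the two possible arcs; embedding it in a surface means embedding its underlying graph. $n(\vec G)$ is the number of vertices of $\vec G$. A $k$-dicolouring of a digraph is a partition of its vertex set into $k$ subsets each inducing an acyclic subdigraph (no directed cycle); the dichromatic number $\vec{\chi}(D)$ is the least $k$ such that $D$ has a $k$-dicolouring. A digraph $D$ is $k$-dicritical if $\vec{\chi}(D)=k$ and $\vec{\chi}(H)<k$ for every proper subdigraph $H$ of $D$. *)

(* Defs.v *)
From mathcomp Require Import all_boot all_order all_algebra.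

Set Implicit Arguments.
Unset Strict Implicit.
Unset Printing Implicit Defensive.

(* A digraph is carried by vertices taken in an ambient finite type, so that
   the subdigraphs of a digraph are digraphs over the same type. *)
Record digraph (T : finType) := Digraph {
  vset : {set T};
  arcs : {set T * T};
  arcs_vset : arcs \subset setX vset vset
}.

Section Digraphs.
Variable T : finType.
Implicit Types (D H : digraph T) (X : {set T}).

Definition arc D : rel T := [rel u v | (u, v) \in arcs D].

Definition subdigraph H D : Prop :=
  (vset H \subset vset D) /\ (arcs H \subset arcs D).

Definition proper_subdigraph H D : Prop := subdigraph H D /\ H <> D.

Lemma induced_arcs D X :
  arcs D :&: setX X X \subset setX (vset D :&: X) (vset D :&: X).
Proof.
apply/subsetP=> -[u v]; rewrite !inE => /and3P[/(subsetP (arcs_vset D))].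
by rewrite inE => /andP[/= -> ->] -> ->.
Qed.

Definition induced D X : digraph T := Digraph (induced_arcs D X).

(* Directed cycles of length 1 (loops) and 2 (digons) count. *)
Definition acyclic D : Prop :=
  forall p : seq T, p != [::] -> ~~ (cycle (arc D) p && uniq p).

Definition dicolouring (k : nat) D (P : {set {set T}}) : Prop :=
  [/\ partition P (vset D), #|P| = k
    & forall X, X \in P -> acyclic (induced D X)].

Definition dicolourable (k : nat) D : Prop := exists P, dicolouring k D P.

(* A relation rather than a function: a digraph with a loop has no
   dichromatic number. *)
Definition dichromatic_number D (k : nat) : Prop :=
  dicolourable k D /\ forall j, dicolourable j D -> j >= k.

Definition dicritical (k : nat) D : Prop :=
  dichromatic_number D k /\
  forall H, proper_subdigraph H D -> exists2 j, dichromatic_number H j & j < k.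

(* Taking u = v, this also excludes loops. *)
Definition oriented D : Prop := forall u v, arc D u v -> ~~ arc D v u.

Definition underlying D : rel T := [rel u v | arc D u v || arc D v u].

End Digraphs.

(* A closed connected surface, orientable or not, given as finitely many
   polygons (one-sided and two-sided ones allowed) whose sides are glued in
   pairs. A flag is one half of a side of one of the polygons, i.e. a side
   together with one of its ends:
   - flag0 x is the other half of the same side;
   - flag1 x is the half-side next to x around the corner of the polygon;
   - flag2 x is the half-side to which x is glued.
   Absence of fixed points means that the surface has no boundary. Every closed
   connected surface arises in this way, by the triangulability of surfaces. *)
Record surface := Surface {
  flag : finType;
  flag0 : flag -> flag;
  flag1 : flag -> flag;
  flag2 : flag -> flag;
  flag0K : involutive flag0;
  flag1K : involutive flag1;
  flag2K : involutive flag2;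
  flag0_neq : forall x, flag0 x != x;
  flag1_neq : forall x, flag1 x != x;
  flag2_neq : forall x, flag2 x != x;
  flag02C : forall x, flag0 (flag2 x) = flag2 (flag0 x);
  flag02_neq : forall x, flag0 (flag2 x) != x;
  flag_inhabited : 0 < #|flag|;
  flag_connected : forall x y : flag,
    connect [rel u v | [|| v == flag0 u, v == flag1 u | v == flag2 u]] x y
}.

Definition orbits2 (F : finType) (f g : F -> F) : {set {set F}} :=
  equivalence_partition (connect [rel u v | (v == f u) || (v == g u)]) [set: F].

(* A cell is the set of the flags incident with it. *)
Definition vertices (S : surface) : {set {set flag S}} :=
  orbits2 (@flag1 S) (@flag2 S).
Definition edges (S : surface) : {set {set flag S}} :=
  orbits2 (@flag0 S) (@flag2 S).
Definition faces (S : surface) : {set {set flag S}} :=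
  orbits2 (@flag0 S) (@flag1 S).

Definition euler_char (S : surface) : int :=
  (#|vertices S|%:Z - #|edges S|%:Z + #|faces S|%:Z)%R.

Definition joins (S : surface) (e p q : {set flag S}) : Prop :=
  exists x, [/\ x \in e, x \in p & flag0 x \in q].

(* The underlying graph of D is drawn as a subgraph of the 1-skeleton. The
   other vertices and edges of the 1-skeleton are not part of the drawing, so
   the faces of the embedded graph (unions of cells) need not be discs:
   embeddings that are not cellular are covered, because every graph embedded
   in a closed surface is part of the 1-skeleton of a decomposition of it into
   polygons. Distinct edges of D get distinct 1-cells as these have distinct
   pairs of ends. *)
Definition embedding (T : finType) (D : digraph T) (S : surface)
    (vmap : T -> {set flag S}) (emap : T -> T -> {set flag S}) : Prop :=
  [/\ forall v, v \in vset D -> vmap v \in vertices S,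
      {in vset D &, injective vmap},
      forall u v, underlying D u v -> emap u v \in edges S,
      forall u v, underlying D u v -> emap u v = emap v u
    & forall u v, underlying D u v -> joins (emap u v) (vmap u) (vmap v)].

(* Main.v *)
Require Import Defs.
From mathcomp Require Import all_boot all_order all_algebra.
From mathcomp Require Import zify.
Import Order.TTheory GRing.Theory Num.Theory.

Set Implicit Arguments.
Unset Strict Implicit.
Unset Printing Implicit Defensive.

(** In a [k]-dicritical digraph every vertex [v] has at least [k - 1]
    out-neighbours: colour [G - v] with fewer than [k] colours; a colour absent
    from the out-neighbourhood of [v] could be given to [v] without creating a
    directed cycle, so all colours occur there, and there are at least
    [k - 1] colours because giving [v] a new one colours [G]. Hence [G] has
    [m >= (k - 1) n] arcs, and the bound [m <= 3 n - 3 c] for simple graphs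
    with [n] vertices and [m >= 2] edges on a surface of Euler characteristic
    [c] gives [(k - 4) n <= - 3 c].

    The bound on [m] has to be proved for drawings whose faces need not be
    discs. A drawing is given by the set [K] of the flags of its edges, together
    with a set of vertices of the 1-skeleton containing the ends of these
    edges. Its faces, called regions here, are the classes of flags under the
    moves [flag0], [flag1] and, away from [K], [flag2]: one may walk around a
    polygon and step over an edge that is not drawn. Two facts about the number
    [r] of regions carry the proof.

    - [n - m + r >= c] ([euler_drawing]). Let the drawing grow to the whole
      1-skeleton. Drawing an edge towards a new vertex keeps [n - m], and it
      does not increase [r], because one can walk around the free end of that
      edge; connectedness of the surface provides such edges until all vertices
      are there. Drawing a further edge lowers [n - m] by one and increases [r]
      by at most one. So [n - m + r] never increases, and it ends at [c].

    - [3 r <= 2 m] when [m >= 2] ([regions_large]): every region has at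
      least three sides.

    Both use the parity argument [boundary_partner]: around a vertex, the
    boundary of a set of flags closed under [flag1] is crossed an even number
    of times. It replaces tracing the boundary walks of the faces. *)

(** * Involutions, components and orbits *)

Section Counting.
Variable T : finType.
Implicit Types (e : rel T) (f g : T -> T) (A : {set T}).

Lemma even_card_involution f A :
  involutive f -> (forall x, f x != x) -> {homo f : x / x \in A} ->
  ~~ odd #|A|.
Proof.
move=> fK fN.
have [m] := ubnP #|A|; elim: m A => // m IHm A ltAm fA.
have [->|[x Ax]] := set_0Vmem A; first by rewrite cards0.
have fAx: f x \in A :\ x by rewrite !inE fN fA.
have eqA: #|A| = #|A :\ x :\ f x|.+2.
  by rewrite (cardsD1 x) Ax (cardsD1 (f x) (A :\ x)) fAx.
rewrite eqA /= negbK; apply: IHm; first by move: ltAm; rewrite eqA; lia.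
move=> y; rewrite !inE => /and3P[yNfx yNx Ay].
by rewrite (inj_eq (inv_inj fK)) yNx (inv_eq fK) yNfx fA.
Qed.

(** Distinct roots in [A] lie in distinct components of [e'], so sending a root
    of [e] to its root for [e'] is injective on [A]. *)
Lemma leq_card_roots e e' (A : {pred T}) :
    connect_sym e -> connect_sym e' ->
    {in A &, forall y z, connect e' y z -> connect e y z} ->
  #|[predI roots e & A]| <= n_comp e' T.
Proof.
move=> syme syme' sub; rewrite -(card_in_imset (f := fingraph.root e')).
  apply/subset_leq_card/subsetP=> _ /imsetP[y _ ->].
  by rewrite unfold_in /= andbT roots_root.
move=> y z; rewrite !inE => /andP[/eqP ry Ay] /andP[/eqP rz Az] /eqP.
rewrite root_connect // => /(sub _ _ Ay Az).
by rewrite -(root_connect syme) ry rz => /eqP.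
Qed.

Lemma leq_n_comp e e' :
  connect_sym e -> connect_sym e' -> subrel e' (connect e) ->
  n_comp e T <= n_comp e' T.
Proof.
move=> syme syme' sub; apply: leq_card_roots => // y z _ _.
exact: connect_sub.
Qed.

(** Joining two components lowers the number of components by at most one:
    outside the component of [b], connectedness is unchanged. *)
Lemma leq_n_comp_glue e e' a b :
    connect_sym e -> connect_sym e' ->
    (forall x y, e' x y -> connect e x y ||
      (connect e a x || connect e b x) && (connect e a y || connect e b y)) ->
  n_comp e T <= (n_comp e' T).+1.
Proof.
move=> syme syme' sub.
pose touched x := connect e a x || connect e b x.
have touchedE x y : connect e x y -> touched x = touched y.
  move=> xy; rewrite /touched.
  by rewrite !(same_connect_r syme xy).
have glue x y : connect e' x y -> connect e x y || touched x && touched y.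
  case/connectP=> p; elim: p x => [|z p IHp] x /=.
    by move=> _ ->; rewrite connect0.
  case/andP=> /sub xz /IHp{}IHp /IHp; rewrite -!/(touched _) in xz * => zy.
  case/orP: xz => [xz|/andP[tx tz]].
    case/orP: zy => [/(connect_trans xz)-> //|].
    by rewrite (touchedE _ _ xz) => ->; rewrite orbT.
  case/orP: zy => [zy|/andP[_ ->]]; last by rewrite tx orbT.
  by rewrite tx -(touchedE _ _ zy) tz orbT.
rewrite (n_compC (connect e b)) n_comp_connect // add1n ltnS.
apply: leq_card_roots => // y z; rewrite !inE => /negPf by_ /negPf bz.
case/glue/orP=> [//|]; rewrite /touched by_ bz !orbF => /andP[ay az].
by rewrite (connect_trans _ az) // syme.
Qed.

Lemma card_equivalence_partition e :
  connect_sym e -> #|equivalence_partition (connect e) [set: T]| = n_comp e T.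
Proof.
move=> syme; pose cls x := [set y in [set: T] | connect e x y].
have clsE: equivalence_partition (connect e) [set: T]
    = cls @: [set x | roots e x].
  apply/setP=> X; apply/imsetP/imsetP=> -[x _ ->]; last by exists x.
  exists (fingraph.root e x); first by rewrite inE roots_root.
  by apply/setP=> y; rewrite !inE /= (same_connect syme (connect_root e x)).
rewrite clsE card_in_imset => [|x y].
  by rewrite cardsE; apply: eq_card => x; rewrite !inE andbT.
rewrite !inE => /eqP rx /eqP ry /setP/(_ y); rewrite !inE connect0 => xy.
by rewrite -rx -ry; apply/eqP; rewrite root_connect.
Qed.

Section Orbits.
Variables f g : T -> T.
Hypotheses (fK : involutive f) (gK : involutive g).

Let step := [rel u v | (v == f u) || (v == g u)].

Lemma orbits2_sym : connect_sym step.
Proof.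
apply: sym_connect_sym => x y /=.
by rewrite (eq_sym y) (eq_sym y) !(inv_eq fK) !(inv_eq gK).
Qed.

Lemma orbits2_eqv :
  {in [set: T] & &, equivalence_rel (connect step)}.
Proof.
move=> x y z _ _ _; split=> [|xy]; first exact: connect0.
exact: (same_connect orbits2_sym).
Qed.

Lemma orbits2_partition : partition (orbits2 f g) [set: T].
Proof. exact: equivalence_partitionP orbits2_eqv. Qed.

Lemma card_orbits2 : #|orbits2 f g| = n_comp step T.
Proof. exact: card_equivalence_partition orbits2_sym. Qed.

Definition orbit2 x := pblock (orbits2 f g) x.

Lemma mem_orbit2 x y : (y \in orbit2 x) = connect step x y.
Proof. by rewrite (pblock_equivalence_partition orbits2_eqv) ?inE. Qed.

Lemma orbit2_in x : orbit2 x \in orbits2 f g.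
Proof. by rewrite pblock_mem // (cover_partition orbits2_partition). Qed.

Lemma orbit2_id x : x \in orbit2 x.
Proof. by rewrite mem_orbit2 connect0. Qed.

Lemma orbit2_def X x : X \in orbits2 f g -> x \in X -> orbit2 x = X.
Proof. exact: def_pblock (partition_trivIset orbits2_partition). Qed.

Lemma orbit2_eq x y : y \in orbit2 x -> orbit2 y = orbit2 x.
Proof. by apply: orbit2_def; apply: orbit2_in. Qed.

Lemma orbit2_left x : orbit2 (f x) = orbit2 x.
Proof. by apply: orbit2_eq; rewrite mem_orbit2 connect1 //= eqxx. Qed.

Lemma orbit2_right x : orbit2 (g x) = orbit2 x.
Proof. by apply: orbit2_eq; rewrite mem_orbit2 connect1 //= eqxx orbT. Qed.

End Orbits.
End Counting.

(** * Drawings in a surface *)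

Section Drawing.
Variable S : surface.
Implicit Types (x y z : flag S) (K C : {set flag S}) (P : {set {set flag S}}).

Local Notation f0 := (@flag0 S).
Local Notation f1 := (@flag1 S).
Local Notation f2 := (@flag2 S).

Definition vertex_of x := orbit2 f1 f2 x.
Definition edge_of x := orbit2 f0 f2 x.

Lemma flag_connected_closed K x :
    x \in K -> {homo f0 : y / y \in K} -> {homo f1 : y / y \in K} ->
    {homo f2 : y / y \in K} ->
  K = [set: flag S].
Proof.
move=> Kx K0 K1 K2; apply/setP=> y; rewrite inE.
have /connectP[p] := flag_connected x y.
elim: p x Kx => [x Kx _ -> //|z p IHp x Kx /= /andP[xz pp]].
by apply: IHp pp; case/or3P: xz => /eqP->; [apply: K0 | apply: K1 | apply: K2].
Qed.

Lemma edge_ofE x : edge_of x = [set x; f0 x; f2 x; f0 (f2 x)].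
Proof.
apply/eqP; rewrite eqEsubset; apply/andP; split; apply/subsetP=> y.
  rewrite mem_orbit2; [|exact: flag0K|exact: flag2K].
  case/connectP=> p + ->; set X := [set x; _; _; _].
  have xX: x \in X by rewrite !inE eqxx.
  elim: p (x) xX => [//|w p IHp z zX] /= /andP[zw]; apply: IHp.
  move: zX; rewrite !inE -!orbA.
  by case/orP: zw => /eqP-> /or4P[]/eqP->;
    rewrite ?(flag0K, flag2K, flag02C) eqxx ?orbT.
have [K0 K2] := (@flag0K S, @flag2K S).
rewrite !inE -!orbA => yx; suff <-: edge_of y = edge_of x by apply: orbit2_id.
by case/or4P: yx => /eqP->;
  rewrite /edge_of ?(orbit2_left K0 K2) ?(orbit2_right K0 K2).
Qed.

Lemma vertex_of_flag1 x : vertex_of (f1 x) = vertex_of x.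
Proof. by rewrite /vertex_of (orbit2_left (@flag1K S) (@flag2K S)). Qed.

Lemma vertex_of_flag2 x : vertex_of (f2 x) = vertex_of x.
Proof. by rewrite /vertex_of (orbit2_right (@flag1K S) (@flag2K S)). Qed.

Lemma vertex_of_in x : vertex_of x \in vertices S.
Proof. exact: orbit2_in (@flag1K S) (@flag2K S) x. Qed.

Lemma card_edge_of x : #|edge_of x| = 4.
Proof.
have x02: f0 x != f2 x.
  by rewrite eq_sym -(inv_eq (@flag0K S)) flag02_neq.
have fN0 y : y != f0 y by rewrite eq_sym flag0_neq.
have fN2 y : y != f2 y by rewrite eq_sym flag2_neq.
pose s := [:: x; f0 x; f2 x; f0 (f2 x)].
have -> : edge_of x = [set y in s].
  by apply/setP=> y; rewrite edge_ofE !inE -!orbA.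
suff /card_uniqP: uniq s by rewrite cardsE.
rewrite /= !inE !negb_or.
by rewrite x02 !fN0 fN2 (eq_sym x (f0 _)) flag02_neq flag02C fN2.
Qed.

Lemma card_flag : #|flag S| = #|edges S| * 4.
Proof.
rewrite -cardsT; have eP := orbits2_partition (@flag0K S) (@flag2K S).
apply: card_uniform_partition (eP) => X XE.
have /set0Pn[x Xx] := partition_neq0 eP XE.
by rewrite -(orbit2_def (@flag0K S) (@flag2K S) XE Xx) card_edge_of.
Qed.

(** A set of edges is encoded as the union of the edges, so that regions and
    numbers of edges are both read off from flags. *)
Definition drawn K :=
  {homo f0 : x / x \in K} /\ {homo f2 : x / x \in K}.

Lemma drawn_flag0 K x : drawn K -> (f0 x \in K) = (x \in K).
Proof.
by case=> K0 _; apply/idP/idP=> [/K0|/K0 //]; rewrite flag0K.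
Qed.

Lemma drawn_flag2 K x : drawn K -> (f2 x \in K) = (x \in K).
Proof.
by case=> _ K2; apply/idP/idP=> [/K2|/K2 //]; rewrite flag2K.
Qed.

Lemma drawn_edge_of x : drawn (edge_of x).
Proof.
have [K0 K2] := (@flag0K S, @flag2K S).
split=> y yx; rewrite /edge_of -(orbit2_eq K0 K2 yx).
  by rewrite -(orbit2_left K0 K2 y) orbit2_id.
by rewrite -(orbit2_right K0 K2 y) orbit2_id.
Qed.

(** The moves that stay inside a face of the drawing [K]. *)
Definition cross K : rel (flag S) :=
  [rel x y | [|| y == f0 x, y == f1 x | (x \notin K) && (y == f2 x)]].

Definition nregions K := n_comp (cross K) (flag S).

Lemma cross_sym K : drawn K -> connect_sym (cross K).
Proof.
move=> dK; apply: sym_connect_sym => x y; rewrite /cross /=.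
rewrite !(eq_sym y) (inv_eq (@flag0K S)) (inv_eq (@flag1K S)).
rewrite (inv_eq (@flag2K S)).
by case: (x =P f2 y) => [->|]; rewrite ?andbF // drawn_flag2.
Qed.

Lemma nregionsT : nregions [set: flag S] = #|faces S|.
Proof.
rewrite /faces card_orbits2; [|exact: flag0K|exact: flag1K].
by apply/eq_n_comp/eq_connect => x y; rewrite /cross /= inE orbF.
Qed.

(** The flags of [C] at a vertex are matched by [flag1], and those whose
    [flag2]-neighbour is in [C] as well are matched by [flag2]; so the number of
    the others is even, and they cannot be just [x]. *)
Lemma boundary_partner C x :
    {homo f1 : y / y \in C} -> x \in C -> f2 x \notin C ->
  exists z, [/\ z != x, z \in C, f2 z \notin C & vertex_of z = vertex_of x].
Proof.
move=> C1 Cx C2x.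
pose A := [set y in C | vertex_of y == vertex_of x].
pose B := [set y | f2 y \in C].
have evenA: ~~ odd #|A|.
  apply: (even_card_involution (@flag1K S)) (@flag1_neq S) _ => y.
  by rewrite !inE vertex_of_flag1 => /andP[/C1-> ->].
have evenAB: ~~ odd #|A :&: B|.
  apply: (even_card_involution (@flag2K S)) (@flag2_neq S) _ => y.
  by rewrite !inE vertex_of_flag2 flag2K => /andP[/andP[-> ->] ->].
have evenD: ~~ odd #|A :\: B|.
  by move: evenA; rewrite -(cardsID B A) oddD (negPf evenAB).
have Dx: x \in A :\: B by rewrite !inE Cx eqxx C2x.
have [D0|[z]] := set_0Vmem ((A :\: B) :\ x).
  by move: evenD; rewrite (cardsD1 x) Dx D0 cards0.
by rewrite !inE => /and4P[zx C2z Cz /eqP vz]; exists z.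
Qed.

Lemma region_closed K x : drawn K ->
  let C := [set y | connect (cross K) x y] in
  [/\ {homo f0 : y / y \in C}, {homo f1 : y / y \in C}
    & forall y, y \in C -> f2 y \notin C -> y \in K].
Proof.
move=> dK C; split=> [y|y|y]; rewrite !inE => Cy.
- by apply: connect_trans Cy (connect1 _); rewrite /cross /= eqxx.
- by apply: connect_trans Cy (connect1 _); rewrite /cross /= eqxx orbT.
apply: contraR => Ky; apply: connect_trans Cy (connect1 _).
by rewrite /cross /= Ky eqxx !orbT.
Qed.

Lemma drawnU K x : drawn K -> drawn (K :|: edge_of x).
Proof.
move=> dK; have dE := drawn_edge_of x.
by split=> y; rewrite !inE ?(drawn_flag0 _ dK, drawn_flag0 _ dE)
  ?(drawn_flag2 _ dK, drawn_flag2 _ dE).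
Qed.

Lemma card_drawnU K x : drawn K -> x \notin K -> #|K :|: edge_of x| = #|K| + 4.
Proof.
move=> dK Kx; rewrite -(card_edge_of x); apply/eqP; rewrite (leq_card_setU K _).
rewrite disjoint_sym disjoint_subset; apply/subsetP=> y.
by rewrite edge_ofE !inE -!orbA => /or4P[]/eqP->;
  rewrite ?(drawn_flag0, drawn_flag2).
Qed.

Lemma cross_edge K x u v : drawn K -> cross K u v ->
  connect (cross (K :|: edge_of x)) u v || (u \in edge_of x) && (v == f2 u).
Proof.
move=> dK /or3P[uv|uv|/andP[Ku uv]].
- by rewrite connect1 // /cross /= uv.
- by rewrite connect1 // /cross /= uv orbT.
case: (boolP (u \in edge_of x)) => [_|ux]; first by rewrite uv orbT.
by rewrite connect1 // /cross /= inE negb_or Ku ux uv !orbT.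
Qed.

Lemma nregions_edge K x :
  drawn K -> nregions (K :|: edge_of x) <= (nregions K).+1.
Proof.
move=> dK; have symK' := cross_sym (drawnU x dK).
apply: (leq_n_comp_glue (a := x) (b := f2 x) symK' (cross_sym dK)).
move=> u v /(cross_edge x dK); set K' := K :|: _.
have side y : connect (cross K') y (f0 y).
  by rewrite connect1 // /cross /= eqxx.
case/orP=> [-> //|/andP[ux /eqP->]].
apply/orP; right; move: ux; rewrite edge_ofE !inE -!orbA => /or4P[]/eqP->;
by rewrite -?flag02C ?flag2K ?connect0 ?side ?orbT.
Qed.

(** The two sides of an edge with a free end at [vertex_of x] are in the same
    region: otherwise [x] would be the only flag at this end where the region
    of [x] is left, against [boundary_partner]. *)
Lemma nregions_pendant K x :
    drawn K -> (forall y, y \in K -> vertex_of y != vertex_of x) ->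
    vertex_of (f0 x) != vertex_of x ->
  nregions (K :|: edge_of x) <= nregions K.
Proof.
move=> dK Kfree x0; set K' := K :|: _.
have dK' : drawn K' by apply: drawnU.
have sym := cross_sym dK'.
pose C := [set y | connect (cross K') x y].
have [C0 C1 C2] := region_closed x dK'.
have xx2: connect (cross K') x (f2 x).
  suff: f2 x \in C by rewrite inE.
  apply: contraT => C2x; have Cx: x \in C by rewrite inE connect0.
  have [z [zx Cz C2z vz]] := boundary_partner C1 Cx C2x.
  have: z \in K' by apply: C2.
  rewrite inE edge_ofE !inE -!orbA => /or4P[/Kfree|/eqP zx'|/eqP zx'|].
  - by rewrite vz eqxx.
  - by rewrite zx' eqxx in zx.
  - by rewrite -vz zx' eqxx in x0.
  case/orP=> /eqP zx'; first by rewrite -zx' Cz in C2x.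
  by rewrite -vz zx' flag02C vertex_of_flag2 eqxx in x0.
have side y : connect (cross K') y (f0 y).
  by rewrite connect1 // /cross /= eqxx.
have x02: connect (cross K') (f0 x) (f0 (f2 x)).
  apply: connect_trans (side _); rewrite sym.
  by apply: connect_trans (side _); rewrite sym.
apply: leq_n_comp => //; first exact: cross_sym.
move=> u v /(cross_edge x dK)/orP[// |/andP[ux /eqP->]].
move: ux; rewrite edge_ofE !inE -!orbA => /or4P[]/eqP->;
by rewrite -?flag02C ?flag2K // sym.
Qed.

(** Multiplied by four, as an edge has four flags, this is [c <= n - m + r].
    Induction on what is missing from the drawing. *)
Lemma euler_drawing K P :
    drawn K -> P \subset vertices S -> P != set0 ->
    (forall x, x \in K -> vertex_of x \in P) ->
  #|vertices S| * 4 + #|faces S| * 4 + #|K|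
    <= #|edges S| * 4 + #|P| * 4 + nregions K * 4.
Proof.
have [m] := ubnP (#|~: K| + #|~: P|).
elim: m K P => // m IHm K P ltm dK PV P0 KP.
have cKC (A : {set flag S}) := cardsC A.
have [PE|PnV] := eqVneq P (vertices S).
  have [KT|KnT] := eqVneq K setT.
    by rewrite PE KT nregionsT cardsT card_flag; lia.
  move: KnT; rewrite -subTset => /subsetPn[x _ Kx].
  have cK := card_drawnU dK Kx; have rK := nregions_edge x dK.
  have ltm' : #|~: (K :|: edge_of x)| + #|~: P| < m.
    by move: (cKC K) (cKC (K :|: edge_of x)); lia.
  have := IHm _ P ltm' (drawnU x dK) PV P0; rewrite cK.
  suff KP' y : y \in K :|: edge_of x -> vertex_of y \in P by move/(_ KP'); lia.
  by rewrite PE vertex_of_in.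
(* By connectedness an edge of the 1-skeleton leaves [P]. *)
have [x Px P0x]: exists2 x, vertex_of x \notin P & vertex_of (f0 x) \in P.
  have [p Pp] := set0Pn _ P0; have pV := subsetP PV p Pp.
  have vP := orbits2_partition (@flag1K S) (@flag2K S).
  have /set0Pn[y py] := partition_neq0 vP pV.
  have vy : vertex_of y = p := orbit2_def (@flag1K S) (@flag2K S) pV py.
  pose A := [set z | vertex_of z \in P].
  have Ay : y \in A by rewrite inE vy.
  case: (pickP [pred x | (vertex_of x \notin P) && (vertex_of (f0 x) \in P)]).
    by move=> x /andP[]; exists x.
  move=> noX; case/negP: PnV; rewrite eqEsubset PV; apply/subsetP=> q qV.
  have AT: A = setT.
    apply: flag_connected_closed Ay _ _ _ => z; rewrite !inE.
    - apply: contraTT => Pz.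
      by have := noX (f0 z); rewrite /= Pz flag0K => /= ->.
    - by rewrite vertex_of_flag1.
    - by rewrite vertex_of_flag2.
  have /set0Pn[z qz] := partition_neq0 vP qV.
  have := in_setT z; rewrite -AT inE.
  by rewrite /vertex_of (orbit2_def (@flag1K S) (@flag2K S) qV qz).
have Kx : x \notin K by apply: contra Px; apply: KP.
have cK := card_drawnU dK Kx.
have rK : nregions (K :|: edge_of x) <= nregions K.
  apply: nregions_pendant => // [y /KP|]; last by apply: contraNneq Px => <-.
  by apply: contraTneq => ->.
have cP : #|vertex_of x |: P| = #|P| + 1 by rewrite cardsU1 Px addnC.
have cPC : #|vertex_of x |: P| + #|~: (vertex_of x |: P)| = #|P| + #|~: P|.
  by rewrite !cardsC.
have ltm' : #|~: (K :|: edge_of x)| + #|~: (vertex_of x |: P)| < m.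
  by move: (cKC K) (cKC (K :|: edge_of x)); lia.
have PV' : vertex_of x |: P \subset vertices S.
  by rewrite subUset sub1set vertex_of_in.
have P0' : vertex_of x |: P != set0.
  by apply/set0Pn; exists (vertex_of x); rewrite setU11.
have := IHm _ _ ltm' (drawnU x dK) PV' P0'; rewrite cK cP.
suff KP' y : y \in K :|: edge_of x -> vertex_of y \in vertex_of x |: P.
  by move/(_ KP'); lia.
rewrite inE => /orP[/KP Py|]; first by rewrite !inE Py orbT.
by rewrite edge_ofE !inE -!orbA => /or4P[]/eqP->;
  rewrite ?flag02C ?vertex_of_flag2 ?eqxx ?P0x ?orbT.
Qed.

(** Every region has three sides, each with two flags. If [flag2] never leaves
    the region, it is the whole surface and [6 <= #|K|] applies. Otherwise some
    side [x] borders another region; by [boundary_partner] the boundary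
    continues with a side [z] at the vertex of [x] and with a side [t] at the
    other end. These three sides are different: if [z] and [t] were the same
    side, it would have the same ends as [x], hence be the other side of the
    same edge of the simple graph, which is not in the region. *)
Lemma regions_large K :
    drawn K -> 6 <= #|K| ->
    (forall x, x \in K -> vertex_of (f0 x) != vertex_of x) ->
    (forall x z, x \in K -> z \in K -> vertex_of z = vertex_of x ->
      vertex_of (f0 z) = vertex_of (f0 x) -> z \in edge_of x) ->
  nregions K * 6 <= #|K|.
Proof.
move=> dK K6 loopless simple; have symK := cross_sym dK.
rewrite -[#|K|]sum1_card.
rewrite (partition_big (fingraph.root (cross K)) (roots (cross K))) /=;
  last by move=> x _; apply: roots_root.
have -> : nregions K = #|roots (cross K)|.
  by apply: eq_card => x; rewrite !inE andbT.
rewrite -sum_nat_const; apply: leq_sum => r rr.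
pose C := [set y | connect (cross K) r y].
have -> : \sum_(x in K | fingraph.root (cross K) x == r) 1 = #|K :&: C|.
  rewrite -sum1_card; apply: eq_bigl => x; rewrite !inE; congr (_ && _).
  by rewrite -(root_connect symK) (eqP rr) eq_sym.
have [C0 C1 C2] := region_closed r dK.
case: (pickP [pred x | (x \in C) && (f2 x \notin C)]) => [x /andP[Cx C2x]|noX].
  have C0E y : (f0 y \in C) = (y \in C).
    by apply/idP/idP=> /C0; rewrite ?flag0K.
  have [z [zx Cz C2z vz]] := boundary_partner C1 Cx C2x.
  have Cx0 : f0 x \in C by rewrite C0E.
  have C2x0 : f2 (f0 x) \notin C by rewrite -flag02C C0E.
  have [t [tx Ct C2t vt]] := boundary_partner C1 Cx0 C2x0.
  have [[Kx Kz] Kt] := (C2 _ Cx C2x, C2 _ Cz C2z, C2 _ Ct C2t).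
  (* [t = flag0 z] would make [z] the other side of the edge of [x]. *)
  have tz : t != f0 z.
    apply: contraNneq C2z => t0z; move: vt.
    rewrite t0z => /(simple _ _ Kx Kz vz).
    rewrite edge_ofE !inE -!orbA => /or4P[]/eqP zE; move: zx vz.
    - by rewrite zE eqxx.
    - by move/eqP: (loopless x Kx); rewrite zE.
    - by rewrite zE flag2K => _ _; move: Cx; rewrite inE.
    - by move/eqP: (loopless x Kx); rewrite zE flag02C vertex_of_flag2.
  pose s := [:: x; f0 x; z; f0 z; t; f0 t].
  have sKC : {subset s <= K :&: C}.
    apply/allP; rewrite /= !(in_setI _ K) !C0E !(drawn_flag0 _ dK).
    by rewrite Kx Kz Kt Cx Cz Ct.
  suff /card_uniqP s6 : uniq s.
    by rewrite -[6]/(size s) -s6; apply/subset_leq_card/subsetP.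
  have inj0 := inj_eq (inv_inj (@flag0K S)).
  have vneq a b : vertex_of a != vertex_of b -> a != b.
    by apply: contraNneq => ->.
  have N0 y : y != f0 y by rewrite eq_sym flag0_neq.
  have xt : x != t by apply: vneq; rewrite vt eq_sym loopless.
  have zt : z != t by apply: vneq; rewrite vz vt eq_sym loopless.
  have zx0 : z != f0 x by apply: vneq; rewrite vz eq_sym loopless.
  have xz0 : x != f0 z by rewrite eq_sym (inv_eq (@flag0K S)).
  have xt0 : x != f0 t by rewrite eq_sym (inv_eq (@flag0K S)).
  have zt0 : z != f0 t by rewrite eq_sym (inv_eq (@flag0K S)).
  rewrite /= !inE !negb_or !inj0.
  by do ?[apply/andP; split]; rewrite // eq_sym.
have -> : C = setT.
  have Cr : r \in C by rewrite inE connect0.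
  apply: flag_connected_closed Cr C0 C1 _ => y Cy.
  by move: (noX y); rewrite /= Cy => /negbFE.
by rewrite setIT.
Qed.

End Drawing.

(** * Dicritical digraphs *)

Local Notation arc := Defs.arc.

Section Dicritical.
Variable T : finType.
Implicit Types (D : digraph T) (X : {set T}) (u v w : T).

Lemma arc_induced D X u v :
  arc (induced D X) u v = [&& arc D u v, u \in X & v \in X].
Proof. by rewrite /arc /= !inE. Qed.

Lemma arc_vset D u v : arc D u v -> (u \in vset D) && (v \in vset D).
Proof. by move/(subsetP (arcs_vset D)); rewrite inE. Qed.

Lemma acyclic_sub (D D' : digraph T) :
  subrel (arc D') (arc D) -> acyclic D -> acyclic D'.
Proof.
move=> sub acD p p0; apply: contra (acD p p0) => /andP[cp ->].
by rewrite (sub_cycle sub).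
Qed.

(** A directed cycle through [v] would leave [v] towards an out-neighbour. *)
Lemma acyclic_setU1 D X v :
    ~~ arc D v v -> (forall w, arc D v w -> w \notin X) ->
  acyclic (induced D X) -> acyclic (induced D (v |: X)).
Proof.
move=> vv noX acX p p0; apply/negP=> /andP[cp up].
have pX u : u \in p ->
    [/\ arc D u (next p u), u \in v |: X & next p u \in v |: X].
  by move/(next_cycle cp); rewrite arc_induced => /and3P.
case: (boolP (v \in p)) => [/pX[vn _]|vp].
  rewrite !inE => /orP[/eqP nv|nX]; first by rewrite nv (negPf vv) in vn.
  by rewrite (negPf (noX _ vn)) in nX.
case/negP: (acX p p0); rewrite up andbT.
have inX u : u \in p -> u \in X.
  move=> pu; have [_ + _] := pX u pu; rewrite !inE => /orP[/eqP uv|//].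
  by rewrite -uv pu in vp.
apply: (sub_in_cycle (P := mem p)) cp => [u w pu pw|]; last exact/allP.
by rewrite !arc_induced => /andP[-> _]; rewrite !inX.
Qed.

Lemma dicritical_outdegree k D v :
    oriented D -> dicritical k D -> v \in vset D ->
  k <= #|[set w | arc D v w]|.+1.
Proof.
move=> orD [[_ minD] critD] Dv.
have vv : ~~ arc D v v by apply/negP=> vv; move: (orD v v vv); rewrite vv.
pose H := induced D (~: [set v]).
have vH : vset H = vset D :\ v by apply/setP=> w; rewrite !inE andbC.
have properH : proper_subdigraph H D.
  split; first by split; apply: subsetIl.
  by move/(congr1 (@vset T)); rewrite vH => /setP/(_ v); rewrite !inE eqxx Dv.
have [j [[P [partP cardP acP]] _] ltjk] := critD H properH.
have acD X : X \in P -> acyclic (induced D X).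
  move=> PX; apply: acyclic_sub (acP X PX) => u w; rewrite !arc_induced.
  have XH u' : u' \in X -> u' \in ~: [set v].
    by move/(subsetP (partitionS partP PX)); rewrite !inE => /andP[].
  by case/and3P=> -> Xu Xw; rewrite Xu Xw !XH.
have vP X : X \in P -> v \notin X.
  move=> PX; apply/negP=> /(subsetP (partitionS partP PX)).
  by rewrite vH !inE eqxx.
(* A colour class avoiding the out-neighbourhood of [v] could absorb [v]. *)
case: (pickP [pred X | (X \in P) && [disjoint X & [set w | arc D v w]]]).
  move=> X /= /andP[PX /pred0P XN].
  have /minD : dicolourable j D; last by rewrite leqNgt ltjk.
  exists ((v |: X) |: (P :\ X)); split.
  - rewrite -(_ : (v |: X) :|: (vset H :\: X) = vset D).
      apply: partitionU1 (partitionD1 partP PX) _ _.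
        by apply/set0Pn; exists v; rewrite setU11.
      rewrite -setI_eq0 vH; apply/eqP/setP=> w; rewrite !inE.
      by case: (w == v) (w \in X) => [] [].
    apply/setP=> w; rewrite vH !inE.
    have [->|_] := eqVneq w v; first by rewrite Dv.
    case: (boolP (w \in X)) => //= Xw.
    have := subsetP (partitionS partP PX) w Xw.
    by rewrite vH !inE => /andP[_ ->].
  - rewrite cardsU1 -cardP (cardsD1 X P) PX; congr (nat_of_bool _ + _).
    by rewrite !inE; apply/nandP; right; apply/negP=> /vP; rewrite setU11.
  - move=> Y; rewrite !inE => /orP[/eqP->|/andP[_ /acD //]].
    apply: acyclic_setU1 (acD X PX) => // w vw; apply/negP=> Xw.
    by have := XN w; rewrite /= Xw inE vw.
(* All classes meet it, and a new class for [v] gives [j.+1] colours. *)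
move=> meetN; have /minD : dicolourable j.+1 D.
  exists ([set v] |: P); split.
  - rewrite -(setD1K Dv); apply: partitionU1; rewrite -?vH //.
      by apply/set0Pn; exists v; rewrite set11.
    by rewrite vH disjoints1 !inE eqxx.
  - rewrite cardsU1 cardP (_ : _ \in P = false) //.
    by apply/negP=> /vP; rewrite set11.
  - move=> Y; rewrite !inE => /orP[/eqP->|/acD //].
    rewrite -[[set v]]setU0; apply: acyclic_setU1 => // [w _|p p0].
      by rewrite inE.
    case: p p0 => // u p _; apply/negP=> /andP[cp _].
    have := next_cycle cp (mem_head u p).
    by rewrite arc_induced !in_set0 !andbF.
move/leq_trans; apply; rewrite ltnS -cardP.
apply: leq_trans (leq_imset_card (pblock P) _).
apply/subset_leq_card/subsetP=> X PX.
have := meetN X; rewrite /= PX => /negbT/pred0Pn[w /andP[Xw Nw]].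
apply/imsetP; exists w => //.
by rewrite (def_pblock (partition_trivIset partP) PX Xw).
Qed.

Lemma card_arcs D : #|arcs D| = \sum_(v in vset D) #|[set w | arc D v w]|.
Proof.
rewrite -sum1_card (partition_big fst (mem (vset D))) /=.
  apply: eq_bigr => v _; rewrite sum1_card.
  have pair_inj : injective (@pair T T v) by move=> u w [].
  rewrite -(card_imset _ pair_inj).
  apply: eq_card => -[u w].
  apply/idP/imsetP=> [/andP[/= uw /eqP<-]|[x + [-> ->]]].
    by exists w; rewrite // inE.
  by rewrite inE unfold_in /= eqxx andbT.
by case=> u w /arc_vset/andP[].
Qed.

Lemma dicritical_vset_neq0 k D : 0 < k -> dicritical k D -> vset D != set0.
Proof.
move=> k0 [[_ minD] _]; apply/negP=> /eqP D0.
have /minD : dicolourable 0 D; last by rewrite leqNgt k0.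
exists set0; split=> [||X]; last by rewrite inE.
  by rewrite D0 partition_set0.
exact: cards0.
Qed.

Lemma dicritical_card_arcs k D :
  oriented D -> dicritical k D -> #|vset D| * k.-1 <= #|arcs D|.
Proof.
move=> orD critD; rewrite card_arcs -sum_nat_const leq_sum // => v Dv.
by have := dicritical_outdegree orD critD Dv; case: k {critD}.
Qed.

End Dicritical.

(** * The edge bound for embedded oriented graphs *)

Section Embedding.
Variables (T : finType) (D : digraph T) (S : surface).
Variables (vmap : T -> {set flag S}) (emap : T -> T -> {set flag S}).
Hypotheses (orD : oriented D) (embD : embedding D vmap emap).
Implicit Types (u v : T) (x y z : flag S) (e : {set flag S}).

Let K0 := @flag0K S.
Let K1 := @flag1K S.
Let K2 := @flag2K S.

Lemma oriented_loopless u : ~~ arc D u u.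
Proof. by apply/negP=> uu; move: (orD uu); rewrite uu. Qed.

Lemma arc_underlying u v : arc D u v -> underlying D u v.
Proof. by rewrite /underlying /= => ->. Qed.

Lemma underlying_sym u v : underlying D u v = underlying D v u.
Proof. by rewrite /underlying /= orbC. Qed.

Lemma underlying_vset u v :
  underlying D u v -> (u \in vset D) && (v \in vset D).
Proof. by case/orP=> /arc_vset; rewrite // andbC. Qed.

Lemma edge_of_mem e x : e \in edges S -> x \in e -> edge_of x = e.
Proof. exact: orbit2_def. Qed.

Lemma vertex_of_vmap u x : u \in vset D -> x \in vmap u -> vertex_of x = vmap u.
Proof.
by case: embD => vmapV _ _ _ _ Du; apply: (orbit2_def K1 K2); apply: vmapV.
Qed.

(** Reversing the edge if necessary, any flag of a drawn edge can be seen as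
    lying at its first end. *)
Lemma emap_ends u v x : underlying D u v -> x \in emap u v ->
  exists u' v', [/\ underlying D u' v', vertex_of x = vmap u',
    vertex_of (flag0 x) = vmap v', emap u' v' = emap u v
    & (u', v') = (u, v) \/ (u', v') = (v, u)].
Proof.
case: embD => _ _ emapE emapC emapJ Uuv xe.
have /andP[Du Dv] := underlying_vset Uuv.
have [y [ye /(vertex_of_vmap Du) uE /(vertex_of_vmap Dv) vE]] := emapJ _ _ Uuv.
have Uvu : underlying D v u by rewrite underlying_sym.
have eC : emap v u = emap u v by rewrite -emapC.
have : x \in edge_of y by rewrite (edge_of_mem (emapE _ _ Uuv)).
rewrite edge_ofE !inE -!orbA.
case/or4P=> /eqP->; [exists u, v | exists v, u | exists u, v | exists v, u];
  split; rewrite ?flag02C ?flag0K ?vertex_of_flag2 //;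
  by [left | right].
Qed.

Definition arc_cells : {set {set flag S}} :=
  [set emap a.1 a.2 | a in arcs D].

Lemma arc_cells_edges : arc_cells \subset edges S.
Proof.
apply/subsetP=> _ /imsetP[[u v] uv ->]; case: embD => _ _ emapE _ _.
exact/emapE/arc_underlying.
Qed.

(** A common 1-cell of two arcs gives them the same ends, so that they are
    equal or opposite, and an oriented graph has no opposite arcs. *)
Lemma card_arc_cells : #|arc_cells| = #|arcs D|.
Proof.
apply: card_in_imset => -[u v] [u' v'] /= uv uv' eE.
case: embD => _ vmap_inj _ _ emapJ.
have /andP[Du Dv] := arc_vset uv; have /andP[Du' Dv'] := arc_vset uv'.
have [y [ye /(vertex_of_vmap Du) yu /(vertex_of_vmap Dv) yv]] :=
  emapJ _ _ (arc_underlying uv).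
rewrite eE in ye.
have [a [b [_ + + _ ab]]] := emap_ends (arc_underlying uv') ye.
rewrite yu yv.
case: ab => [] [-> ->] /vmap_inj ua /vmap_inj vb.
  by rewrite (ua Du Du') (vb Dv Dv').
by case/negP: (orD uv'); rewrite -(ua Du Dv') -(vb Dv Du').
Qed.

Lemma cover_arc_cells x : x \in cover arc_cells -> exists u v,
  [/\ underlying D u v, vertex_of x = vmap u, vertex_of (flag0 x) = vmap v,
    emap u v = edge_of x & edge_of x \subset cover arc_cells].
Proof.
case/bigcupP=> e Qe xe.
have xE := edge_of_mem (subsetP arc_cells_edges e Qe) xe.
case/imsetP: (Qe) => -[u v] /= /arc_underlying Uuv eE; rewrite eE in xe.
have [u' [v' [? ? ? ? _]]] := emap_ends Uuv xe.
by exists u', v'; rewrite xE {1}eE; split=> //; apply: bigcup_sup Qe.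
Qed.

Lemma drawn_arc_cells : drawn (cover arc_cells).
Proof.
split=> x /cover_arc_cells[_ [_ [_ _ _ _ /subsetP EK]]]; apply: EK.
  by apply: (drawn_edge_of x).1; apply: orbit2_id.
by apply: (drawn_edge_of x).2; apply: orbit2_id.
Qed.

Lemma card_cover_arc_cells : #|cover arc_cells| = #|arcs D| * 4.
Proof.
have eP := orbits2_partition K0 K2.
have /eqP<- : trivIset arc_cells.
  exact: trivIsetS arc_cells_edges (partition_trivIset eP).
rewrite -card_arc_cells -sum_nat_const; apply: eq_bigr => e Qe.
have eS := subsetP arc_cells_edges e Qe.
have /set0Pn[x xe] := partition_neq0 eP eS.
by rewrite -(edge_of_mem eS xe) card_edge_of.
Qed.

(** This is [m <= 3 n - 3 c]. *)
Lemma euler_embedding : vset D != set0 -> 1 < #|arcs D| ->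
  (#|vertices S| + #|faces S|) * 3 + #|arcs D|
    <= #|vset D| * 3 + #|edges S| * 3.
Proof.
move=> D0 D2; have [vmapV vmap_inj _ _ _] := embD.
have PV : vmap @: vset D \subset vertices S.
  by apply/subsetP=> _ /imsetP[u Du ->]; apply: vmapV.
have P0 : vmap @: vset D != set0 by rewrite imset_eq0.
have KP x : x \in cover arc_cells -> vertex_of x \in vmap @: vset D.
  case/cover_arc_cells=> u [v [/underlying_vset/andP[Du _] -> _ _ _]].
  exact: imset_f.
have := euler_drawing drawn_arc_cells PV P0 KP.
rewrite (card_in_imset vmap_inj).
have cK := card_cover_arc_cells.
suff : nregions (cover arc_cells) * 6 <= #|cover arc_cells| by rewrite cK; lia.
apply: regions_large; first exact: drawn_arc_cells.
- by rewrite cK; lia.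
- move=> x /cover_arc_cells[u [v [Uuv -> -> _ _]]].
  have /andP[Du Dv] := underlying_vset Uuv.
  apply/negP=> /eqP/vmap_inj vu; move: Uuv; rewrite vu //.
  by rewrite /underlying /= orbb (negPf (oriented_loopless u)).
move=> x z /cover_arc_cells[u [v [Uuv -> -> xE _]]].
move=> /cover_arc_cells[u' [v' [Uuv' -> -> zE _]]].
have /andP[Du Dv] := underlying_vset Uuv.
have /andP[Du' Dv'] := underlying_vset Uuv'.
move=> /vmap_inj uu /vmap_inj vv.
by rewrite -xE -uu // -vv // zE orbit2_id.
Qed.

End Embedding.

(** * The bound on the order *)

Local Open Scope ring_scope.

Theorem proposition2p2 (k : nat) (T : finType) (G : digraph T)
    (S : surface) (c : int)
    (vmap : T -> {set flag S}) (emap : T -> T -> {set flag S}) :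
  (5 <= k)%N ->
  oriented G ->
  dicritical k G ->
  euler_char S = c ->
  embedding G vmap emap ->
  (#|vset G|%:R : rat) <= (- 3 * c%:~R) / (k%:R - 4).
Proof.
move=> k5 orG critG <- embG.
have G0 : vset G != set0.
  by apply: dicritical_vset_neq0 critG; apply: leq_trans k5.
have n0 : (0 < #|vset G|)%N by rewrite card_gt0.
have [j kE] : exists j, k = (j.+1 + 4)%N.
  by exists (k - 5)%N; lia.
have mn : (#|vset G| * j.+1 + #|vset G| * 3 <= #|arcs G|)%N.
  by rewrite -mulnDr; have := dicritical_card_arcs orG critG; rewrite kE addnS.
have m1 : (1 < #|arcs G|)%N by lia.
have euler := euler_embedding orG embG G0 m1.
have k4 : k%:R - 4 = j.+1%:R :> rat by rewrite kE natrD addrK.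
rewrite k4 ler_pdivlMr ?ltr0n //.
have : (#|vset G| * j.+1)%:Z <= - 3 * euler_char S.
  by rewrite /euler_char; lia.
by rewrite -(ler_int rat) intrM mulrNz -!pmulrn natrM.
Qed.
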